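(* Let $d \ge 1$ be an integer, let $A$ be a set of nonnegative integers with $0 \in A$ and $|A| = d$, and put $\Omega = A + [0,1]$. Let $\Gamma = \{\gamma_0, \gamma_1, \dots, \gamma_{d-1}\} \subset \mathbb{R}$ with $\gamma_0 = 0$ and the $\gamma_j$ pairwise incongruent modulo $1$, and put $\Lambda = \Gamma + \mathbb{Z}$. Suppose that $(\Omega, \Lambda)$ is a spectral pair. Let $F$ be the exceptional set of integer zeros associated with $\Gamma$, i.e. $F = Z(\widehat{\delta_\Gamma}) \setminus X$ with $Z(\widehat{\delta_\Gamma})$ and $X$ as defined in the context. Then $\Lambda$ is rational (that is, $\Lambda \subset \mathbb{Q}$) if and only if $(A - A) \cap F = \emptyset$.
   Context: Spectral pair: for $\Omega = A + [0,1]$ with $|A| = d$ (so $\Omega$ has Lebesgue measure $d$), $(\Omega, \Lambda)$ is a spectral pair if $\{ \frac{1}{\sqrt{d}} e^{2\pi i \lambda x}|_{\Omega} : \lambda \in \Lambda \}$ is an orthonormal basis of $L^2(\Omega)$. $A - A = \{a - a' : a, a' \in A\}$. For a finite set $S \subset \mathbb{R}$ put $\widehat{\delta_S}(x) = \sum_{\gamma \in S} e^{2\pi i \gamma x}$ for $x \in \mathbb{R}$, and $Z(\widehat{\delta_S}) = \{ k \in \mathbb{Z} : \widehat{\delta_S}(k) = 0 \}$. Define an equivalence relation on $\Gamma$ by $\gamma \sim \gamma'$ if and only if $\gamma - \gamma' \in \mathbb{Q}$, and let $\Gamma = \bigcup_{j=1}^{k} \Gamma_j^*$ be the partition of $\Gamma$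 into equivalence classes. Put $X = \bigcap_{j=1}^{k} Z(\widehat{\delta_{\Gamma_j^*}})$, which is a subset of $Z(\widehat{\delta_\Gamma})$, and $F = Z(\widehat{\delta_\Gamma}) \setminus X$. *)

(* Defs.v *)
From HB Require Import structures.
From mathcomp Require Import all_boot all_order all_algebra finmap.
From mathcomp Require Import complex.
From mathcomp Require Import all_classical all_reals all_analysis.

Set Implicit Arguments.
Unset Strict Implicit.
Unset Printing Implicit Defensive.
Import Order.TTheory GRing.Theory Num.Theory.
Import numFieldNormedType.Exports.

Local Open Scope classical_set_scope.
Local Open Scope ring_scope.
Local Open Scope complex_scope.

Section ComplexL2.
Context {R : realType}.
Implicit Types (D : set R) (f g : R -> R[i]).

Definition cexpi (t : R) : R[i] := cos t +i* sin t.

Definition cintegral D f : R[i] :=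
  (\int[lebesgue_measure]_(x in D) complex.Re (f x)) +i*
  (\int[lebesgue_measure]_(x in D) complex.Im (f x)).

(* Representatives of elements of the complex Hilbert space L^2(D); functions
   are total on R, but only their values on D matter. Measurability is Borel:
   every class of L^2(D) has a Borel representative. *)
Definition L2 D : set (R -> R[i]) := [set f : R -> R[i] |
  [/\ measurable_fun D (fun x : R => complex.Re (f x)),
      measurable_fun D (fun x : R => complex.Im (f x)) &
      lebesgue_measure.-integrable D (fun x : R => (Normc.normc (f x) ^+ 2)%:E)]].

Definition L2inner D f g : R[i] := cintegral D (fun x => f x * (g x)^*).

Definition L2norm D f : R :=
  Num.sqrt (\int[lebesgue_measure]_(x in D) (Normc.normc (f x) ^+ 2)).

(* The indexed family (e i), i in J, is an orthonormal system in L^2(D) whose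
   finite linear combinations are dense in L^2(D). *)
Definition orthonormal_basis (I : choiceType) D (J : set I)
    (e : I -> R -> R[i]) : Prop :=
  [/\ (forall i, J i -> L2 D (e i)),
      (forall i j, J i -> J j -> L2inner D (e i) (e j) = (i == j)%:R) &
      (forall f, L2 D f -> forall eps : R, 0 < eps ->
         exists (s : {fset I}) (c : I -> R[i]), [set` s] `<=` J /\
           L2norm D (fun x => f x - \sum_(i <- s) c i * e i x) < eps)].

End ComplexL2.

Section SpectralPairs.
Context {R : realType}.

Definition Omega_of (A : {fset nat}) : set R :=
  [set a%:R + t | a in [set` A] & t in `[0, 1]].

(* The factor is 1 / sqrt d with d = |A|, the Lebesgue measure of A + [0,1]. *)
Definition spectral_pair (A : {fset nat}) (Lambda : set R) : Prop :=
  orthonormal_basis (Omega_of A) Lambda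
    (fun (lambda x : R) =>
       ((Num.sqrt (#|` A|%:R))^-1)%:C * cexpi (2 * pi * lambda * x)).

Definition plus_Z (G : {fset R}) : set R :=
  [set g + n%:~R | g in [set` G] & n in [set: int]].

Definition diff_set (A : {fset nat}) : set int :=
  [set a%:Z - b%:Z | a in [set` A] & b in [set` A]].

Definition delta_hat (S : {fset R}) (x : R) : R[i] :=
  \sum_(g <- S) cexpi (2 * pi * g * x).

Definition int_zeros (S : {fset R}) : set int :=
  [set k : int | delta_hat S k%:~R = 0].

Definition rat_equiv (g g' : R) : bool := `[< rational (g - g') >].

Definition rat_classes (G : {fset R}) : {fset {fset R}} :=
  [fset [fset g' in G | rat_equiv g g'] | g in G]%fset.

Definition class_zeros (G : {fset R}) : set int :=
  \bigcap_(C in [set` rat_classes G]) int_zeros C.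

Definition exceptional_zeros (G : {fset R}) : set int :=
  int_zeros G `\` class_zeros G.

End SpectralPairs.

(* Main.v *)
Require Import Defs.
From HB Require Import structures.
From mathcomp Require Import all_boot all_order all_algebra finmap.
From mathcomp Require Import complex.
From mathcomp Require Import all_classical all_reals all_analysis.
From mathcomp Require Import measurable_realfun ring lra.

Set Implicit Arguments.
Unset Strict Implicit.
Unset Printing Implicit Defensive.
Import Order.TTheory GRing.Theory Num.Theory.
Import numFieldNormedType.Exports.

Local Open Scope classical_set_scope.
Local Open Scope ring_scope.

(** Write e(t) for exp(it). Everything comes from the square matrix
M = (e(2 pi g a)), with rows indexed by g in Gamma and columns by a in A.

Up to a nonzero factor, the inner product over A + [0,1] of the exponentials
of frequencies g and h is the sum over a in A of e(2 pi (g - h) a), because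
the integral over [a, a + 1] is e(2 pi (g - h) a) times a quantity that does
not depend on a and vanishes only when g - h is a nonzero integer
([cintegral_Omega_of_cexpi]). So orthonormality says that the rows of M are
orthogonal ([sum_cexpi_eq0_of_spectral_pair]). Since M is square, its columns
are orthogonal too, that is, every nonzero difference of two elements of A is
an integer zero of the transform of Gamma ([delta_hat_diff_eq0]).

If Lambda is rational, Gamma is its own unique rational class, and there are
no exceptional zeros. Conversely, suppose that A - A has no exceptional zero.
Then the nonzero differences of A are zeros for each class separately, in
particular for the class C of 0: the rows of M indexed by C still have
orthogonal columns. A matrix with #|C| rows has at most #|C| nonzero
orthogonal columns ([card_le_of_delta_hat_diff]), so #|C| is at least
#|A| = #|Gamma|, the class C is all of Gamma, and Gamma is rational. *)

Section Spectrum.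
Context {R : realType}.
Local Open Scope complex_scope.
Notation mu := (@lebesgue_measure R).

(** * The complex exponential *)

Lemma cexpi0 : cexpi (0 : R) = 1.
Proof. by rewrite /cexpi cos0 sin0. Qed.

Lemma cexpiD (s t : R) : cexpi (s + t) = cexpi s * cexpi t.
Proof.
by rewrite /cexpi cosD sinD; apply/eqP; rewrite eq_complex /= eqxx addrC mulrC
  [sin t * _]mulrC eqxx.
Qed.

Lemma conj_cexpi (t : R) : Num.conj (cexpi t) = cexpi (- t).
Proof. by rewrite /cexpi cosN sinN. Qed.

Lemma cexpi_eq1_int (t : R) : cexpi (2 * pi * t) = 1 -> t \is a Num.int.
Proof.
(* Conjugation exchanges t and -t, so the integer part of t may be taken in
   nat; the half-angle formula then turns cos (2 pi f) = 1, for the fractional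
   part f, into sin (pi f) = 0. *)
wlog t0 : t / 0 <= t.
  move=> H; have [/H//|/ltW t0 e1] := leP 0 t.
  rewrite -[t]opprK rpredN H ?oppr_ge0// mulrN -conj_cexpi e1.
  by apply/eqP; rewrite eq_complex /= oppr0 !eqxx.
case=> + _; have /andP[] := truncn_itv t0.
set n := Num.truncn t => nt tn.
have -> : 2 * pi * t = pi * (t - n%:R) *+ 2 + pi *+ 2 *+ n.
  rewrite -[in RHS]mulr_natl -[pi *+ 2 *+ n]mulr_natl -[pi *+ 2]mulr_natl.
  ring.
rewrite (periodicn (@cosD2pi R)) cos_mulr2n cos2sin2 => e1.
have /eqP : sin (pi * (t - n%:R)) ^+ 2 = 0 by move: e1; rewrite -mulr_natr; lra.
rewrite sqrf_eq0 => /eqP s0; have [->|tneq] := eqVneq t n%:R; first exact: intr_nat.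
have : 0 < sin (pi * (t - n%:R)).
  apply: sin_gt0_pi; rewrite pmulr_rgt0 ?pi_gt0// subr_gt0 lt_neqAle eq_sym tneq nt/=.
  by rewrite -[ltRHS]mulr1 ltr_pM2l ?pi_gt0// ltrBlDl natr1.
by rewrite s0 ltxx.
Qed.

Lemma scaled_cexpi_conjM (k s t : R) :
  k%:C * cexpi s * Num.conj (k%:C * cexpi t) = (k * k)%:C * cexpi (s - t).
Proof.
rewrite /cexpi cosB sinB; apply/eqP; rewrite eq_complex /=.
by apply/andP; split; apply/eqP; ring.
Qed.

(** * Integrals over A + [0,1] *)

Lemma Rintegral_segment_FTC (f F : R -> R) (a b : R) : a < b ->
  continuous f -> (forall x : R, is_derive x (1 : R) F (f x)) ->
  \int[mu]_(x in `[a, b]) f x = F b - F a.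
Proof.
move=> ab cf dF.
have cF : continuous F.
  by move=> x; apply: differentiable_continuous; apply/derivable1_diffP; case: (dF x).
rewrite /Rintegral (@continuous_FTC2 _ f F a b)//.
- exact: continuous_subspaceT.
- split; first by move=> x _; case: (dF x).
  + by apply: cvg_at_right_filter; exact: cF.
  + by apply: cvg_at_left_filter; exact: cF.
- by move=> x _; rewrite derive1E; case: (dF x).
Qed.

Lemma Omega_ofE (A : {fset nat}) :
  Omega_of A = \big[setU/set0]_(a <- A) `[a%:R, a%:R + 1]%classic :> set R.
Proof.
rewrite -bigcup_seq; apply/seteqP; split => x /=.
  move=> [a aA [t]]; rewrite /= in_itv/= => /andP[t0 t1] <-; exists a => //=.
  by rewrite in_itv/=; apply/andP; split; lra.
move=> [a aA]; rewrite /= in_itv/= => /andP[ax xa].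
exists a => //; exists (x - a%:R); last by lra.
by rewrite /= in_itv/=; apply/andP; split; lra.
Qed.

(** Consecutive elements of [A] give intervals that share an endpoint. The
finite set [N] of right endpoints is negligible, and off [N] the set is the
disjoint union [D] of half-open intervals. *)
Lemma Rintegral_Omega_of_FTC (A : {fset nat}) (f F : R -> R) :
  continuous f -> (forall x : R, is_derive x (1 : R) F (f x)) ->
  \int[mu]_(x in Omega_of A) f x = \sum_(a <- A) (F (a%:R + 1) - F a%:R).
Proof.
move=> cf dF.
pose N : set R := [set a%:R + 1 | a in [set` A]].
pose D : set R := \big[setU/set0]_(a <- A) `[a%:R, a%:R + 1[%classic.
have mf E : measurable_fun E f.
  by apply: measurable_funTS; exact: continuous_measurable_fun.
have cN : countable N.
  by apply: finite_set_countable; apply: finite_image; exact: finite_fset.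
have mN : measurable N by exact: countable_measurable.
have N0 : mu N = 0%E by exact: countable_lebesgue_measure0.
have mD : measurable D.
  by apply: bigsetU_measurable => a _; exact: measurable_itv.
have iO : mu.-integrable (Omega_of A) (EFin \o f).
  apply: continuous_compact_integrable; last exact: continuous_subspaceT.
  rewrite Omega_ofE; apply: bigsetU_compact => a _; exact: segment_compact.
have mO : measurable (Omega_of A : set R).
  by rewrite Omega_ofE; apply: bigsetU_measurable => a _; exact: measurable_itv.
have DO : D `<=` Omega_of A.
  rewrite Omega_ofE /D -!bigcup_seq; apply: subset_bigcup => a _.
  by apply: subset_itvl; rewrite bnd_simp.
have iD : mu.-integrable D (EFin \o f) by exact: integrableS iO.
have ON : Omega_of A `\` N = D `\` N.
  apply/seteqP; split; last by move=> x [/DO].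
  move=> x [Ox Nx]; split=> //; move: Ox; rewrite Omega_ofE /D -!bigcup_seq.
  move=> [a /= aA]; rewrite /= !in_itv/= => /andP[ax].
  rewrite le_eqVlt => /predU1P[xa|xa]; first by exfalso; apply: Nx; exists a.
  by exists a => //=; rewrite in_itv/= ax.
rewrite /Rintegral (@negligible_integral _ _ _ mu _ N)// ON.
rewrite -(@negligible_integral _ _ _ mu _ N)// integral_bigsetU_EFin//.
- rewrite (eq_bigr (fun a => (F (a%:R + 1) - F a%:R)%:E)) ?sumEFin// => a _.
  rewrite integral_itv_bndo_bndc; last exact/measurable_EFinP.
  rewrite -(Rintegral_segment_FTC _ cf dF) ?ltrDl// /Rintegral fineK//.
  apply: integrable_fin_num; first exact: measurable_itv.
  apply: continuous_compact_integrable; last exact: continuous_subspaceT.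
  exact: segment_compact.
- apply/trivIsetP => a b _ _ ab; rewrite -subset0 => x [] /=.
  rewrite !in_itv/= => /andP[ax xa] /andP[bx xb].
  have : (a%:R < b.+1%:R :> R) && (b%:R < a.+1%:R :> R).
    by rewrite -!natr1 (le_lt_trans ax xb) (le_lt_trans bx xa).
  by rewrite !ltr_nat !ltnS -eqn_leq (negPf ab).
- by apply/measurable_EFinP; exact: mf.
Qed.

(** The factor [0 -i* (k / w)] is k / (i w), which comes from the antiderivative
of k e(wx); each interval [a, a + 1] contributes e(w (a + 1)) - e(w a), which
is e(w a) (e(w) - 1). *)
Lemma cintegral_Omega_of_cexpi (A : {fset nat}) (k w : R) : w != 0 ->
  cintegral (Omega_of A) (fun x => k%:C * cexpi (w * x)) =
  (0 -i* (k / w)) * (cexpi w - 1) * \sum_(a <- A) cexpi (w * a%:R).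
Proof.
move=> w0.
have cw : continuous (fun x : R => w * x) by exact: mulrl_continuous.
have dsin x : is_derive x (1 : R) (fun x => k / w * sin (w * x)) (k * cos (w * x)).
  by apply: is_derive_eq; rewrite /GRing.scale/=; field.
have dcos x : is_derive x (1 : R) (fun x => - (k / w) * cos (w * x)) (k * sin (w * x)).
  by apply: is_derive_eq; rewrite /GRing.scale/=; field.
have ccos : continuous (fun x : R => k * cos (w * x)).
  move=> x; apply: cvgM; first exact: cvg_cst.
  by apply: continuous_comp; [exact: cw|exact: continuous_cos].
have csin : continuous (fun x : R => k * sin (w * x)).
  move=> x; apply: cvgM; first exact: cvg_cst.
  by apply: continuous_comp; [exact: cw|exact: continuous_sin].
transitivity ((\int[mu]_(x in Omega_of A) (k * cos (w * x)))
    +i* (\int[mu]_(x in Omega_of A) (k * sin (w * x)))).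
  rewrite /cintegral; congr (_ +i* _); apply: eq_Rintegral => x _ /=;
    by rewrite mul0r ?subr0 ?addr0.
rewrite (Rintegral_Omega_of_FTC _ ccos dsin) (Rintegral_Omega_of_FTC _ csin dcos).
rewrite mulr_sumr; under [RHS]eq_bigr => a _ do rewrite -mulrA mulrBl mul1r -cexpiD.
elim: (A : seq nat) => [|a s ih]; first by rewrite !big_nil.
rewrite !big_cons -ih /cexpi mulrDr mulr1 [w + _]addrC.
by apply/eqP; rewrite eq_complex /=; apply/andP; split; apply/eqP; ring.
Qed.

(** Of the three factors of the vanishing inner product, the constant is nonzero
and e(2 pi (g - h)) - 1 is nonzero because g - h is not an integer. *)
Lemma sum_cexpi_eq0_of_spectral_pair (A : {fset nat}) (L : set R) (g h : R) :
  spectral_pair A L -> L g -> L h -> g - h \isn't a Num.int ->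
  \sum_(a <- A) cexpi (2 * pi * (g - h) * a%:R) = 0.
Proof.
move=> [_ orth _] Lg Lh ghZ.
have gh : g - h != 0 by apply: contraNneq ghZ => ->; exact: rpred0.
have w0 : 2 * pi * (g - h) != 0 by rewrite !mulf_neq0// gt_eqF ?pi_gt0.
have [->|A0] := eqVneq A fset0%fset; first by rewrite big_seq_fset0.
set k : R := (Num.sqrt (#|` A|%:R : R))^-1.
have k0 : k != 0.
  by rewrite invr_neq0// gt_eqF// sqrtr_gt0 ltr0n cardfs_gt0.
have := orth g h Lg Lh; rewrite -subr_eq0 (negPf gh) /L2inner.
rewrite (_ : (fun x => _) = (fun x => (k * k)%:C * cexpi (2 * pi * (g - h) * x))); last first.
  by apply/funext => x; rewrite scaled_cexpi_conjM; congr (_ * cexpi _); ring.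
have kw0 : k * k / (2 * pi * (g - h)) != 0.
  by rewrite mulf_neq0 ?mulf_neq0//; exact: invr_neq0.
rewrite cintegral_Omega_of_cexpi// => /eqP; rewrite !mulf_eq0 -orbA => /or3P[].
- by rewrite eq_complex/= oppr_eq0 (negPf kw0) andbF.
- by rewrite subr_eq0 => /eqP/cexpi_eq1_int; rewrite (negPf ghZ).
- by move/eqP.
Qed.

(** * The Fourier matrix of a set of frequencies and a set of integers *)

(** The dimensions are separate parameters, so that the matrix of two lists of
provably equal sizes is square by typing. *)
Definition fourier_mx m n (S : seq R) (A : seq nat) : 'M[R[i]]_(m, n) :=
  \matrix_(i, j) cexpi (2 * pi * S`_i * (nth 0%N A j)%:R).

Lemma fourier_mx_gram_rows n m (S : seq R) (A : seq nat) i j :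
  size A = n ->
  (fourier_mx m n S A *m (map_mx (@Num.conj R[i]) (fourier_mx m n S A))^T) i j =
  \sum_(a <- A) cexpi (2 * pi * (S`_i - S`_j) * a%:R).
Proof.
move=> sA; rewrite mxE (big_nth 0%N) sA big_mkord; apply: eq_bigr => a _.
by rewrite !mxE conj_cexpi -cexpiD; congr cexpi; ring.
Qed.

Lemma fourier_mx_gram_cols n m (S : seq R) (A : seq nat) i j :
  size S = m ->
  ((map_mx (@Num.conj R[i]) (fourier_mx m n S A))^T *m fourier_mx m n S A) i j =
  \sum_(g <- S) cexpi (2 * pi * g * ((nth 0%N A j)%:Z - (nth 0%N A i)%:Z)%:~R).
Proof.
move=> sS; rewrite mxE (big_nth 0) sS big_mkord; apply: eq_bigr => a _.
by rewrite !mxE conj_cexpi -cexpiD rmorphB/=; congr cexpi; ring.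
Qed.

(** A one-sided inverse of a square matrix is two-sided: if the rows of the
Fourier matrix are orthogonal, so are its columns, whose inner products are
values of [delta_hat S]. *)
Lemma delta_hat_diff_eq0 (S : {fset R}) (A : {fset nat}) :
  #|` S|%fset = #|` A|%fset ->
  (forall g h, g \in S -> h \in S -> g != h ->
     \sum_(a <- A) cexpi (2 * pi * (g - h) * a%:R) = 0) ->
  forall a b, a \in A -> b \in A -> a != b ->
  delta_hat S (a%:Z - b%:Z)%:~R = 0.
Proof.
move=> SA orth a b aA bA ab.
set n := #|` A|%fset in SA; have nA : size A = n by [].
pose M := fourier_mx n n S A; pose M' := (map_mx (@Num.conj R[i]) M)^T.
have n0 : (n%:R : R[i]) != 0.
  rewrite pnatr_eq0 -nA size_eq0; apply: contraTneq aA => A0.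
  by rewrite -[_ \in _]/(_ \in (A : seq _)) A0.
have MM' : M *m M' = n%:R%:M.
  apply/matrixP => i j; rewrite fourier_mx_gram_rows// mxE.
  have [->|ij] := eqVneq i j.
    under eq_bigr do rewrite subrr mulr0 mul0r cexpi0.
    by rewrite big_const_seq count_predT nA iter_addr_0.
  rewrite orth ?mem_nth ?SA//.
  by rewrite nth_uniq ?SA ?fset_uniq.
have M'M : M' *m M = n%:R%:M.
  have : M *m (n%:R^-1 *: M') = 1%:M.
    by rewrite -scalemxAr MM' scale_scalar_mx mulVf.
  move/mulmx1C; rewrite -scalemxAl => /(congr1 (fun X => n%:R *: X)).
  by rewrite scalerA mulfV// scale1r => ->; rewrite scale_scalar_mx mulr1.
have ia : (index a A < n)%N by rewrite -nA index_mem.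
have ib : (index b A < n)%N by rewrite -nA index_mem.
have := fourier_mx_gram_cols A (Ordinal ib) (Ordinal ia) SA.
rewrite M'M mxE /= !nth_index// /delta_hat => <-.
case: eqP => // -[] /(congr1 (nth 0%N A)); rewrite !nth_index// => e.
by rewrite e eqxx in ab.
Qed.

(** The hypothesis says that the columns of the Fourier matrix are orthogonal,
and each has squared norm #|S| > 0: they are independent,
so their number is at most the number of rows. *)
Lemma card_le_of_delta_hat_diff (S : {fset R}) (A : {fset nat}) :
  (0 < #|` S|)%N ->
  (forall a b, a \in A -> b \in A -> a != b ->
     delta_hat S (a%:Z - b%:Z)%:~R = 0) ->
  (#|` A|%fset <= #|` S|%fset)%N.
Proof.
move=> S0 orth; set m := #|` S|%fset in S0 *; set n := #|` A|%fset.
have mS : size S = m by []. have nA : size A = n by [].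
pose M := fourier_mx m n S A; pose M' := (map_mx (@Num.conj R[i]) M)^T.
have m0 : (m%:R : R[i]) != 0 by rewrite pnatr_eq0 -lt0n.
have M'M : M' *m M = m%:R%:M.
  apply/matrixP => i j; rewrite fourier_mx_gram_cols// mxE.
  have [->|ij] := eqVneq i j.
    under eq_bigr do rewrite subrr mulr0 cexpi0.
    by rewrite big_const_seq count_predT mS iter_addr_0.
  apply: orth; rewrite ?mem_nth ?nA//.
  by rewrite nth_uniq ?nA ?fset_uniq// eq_sym.
rewrite -(mxrank1 R[i] n) (_ : 1%:M = m%:R^-1 *: M' *m M); last first.
  by rewrite -scalemxAl M'M scale_scalar_mx mulVf.
exact: leq_trans (mxrankM_maxr _ _) (rank_leq_row _).
Qed.

End Spectrum.

(** * Rational spectra *)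

Lemma plus_Z_sub_rational (R : realType) (S : {fset R}) :
  (forall g, g \in S -> rational g) -> plus_Z S `<=` rational.
Proof.
move=> rS x [g gS [n _ <-]]; have [q _ <-] := rS _ gS.
by exists (q + n%:~R) => //; rewrite rmorphD/= ratr_int.
Qed.

Theorem theorem3 (R : realType) (d : nat) (hd : (0 < d)%N)
    (A : {fset nat}) (hA0 : (0%N \in A)%fset) (hA : #|` A|%fset = d)
    (gamma : 'I_d -> R) (hgamma0 : gamma (Ordinal hd) = 0)
    (hgamma : forall i j : 'I_d, i != j -> gamma i - gamma j \isn't a Num.int)
    (Gamma : {fset R}) (hGamma : Gamma = [fset gamma i | i in 'I_d]%fset)
    (hspec : spectral_pair A (plus_Z Gamma)) :
  plus_Z Gamma `<=` rational <->
  diff_set A `&` exceptional_zeros Gamma = set0.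
Proof.
have gamma_inj : injective gamma.
  move=> i j gij; apply/eqP; apply: contraT => /hgamma.
  by rewrite gij subrr rpred0.
have sub_plus_Z g : g \in Gamma -> plus_Z Gamma g.
  by move=> gG; exists g => //; exists 0 => //; rewrite addr0.
have GammaA : #|` Gamma|%fset = #|` A|%fset.
  by rewrite hA hGamma card_imfset//= -cardE card_ord.
have Gamma0 : 0 \in Gamma.
  by rewrite hGamma -hgamma0; apply/imfsetP; exists (Ordinal hd).
have zeros a b : a \in A -> b \in A -> a != b ->
    delta_hat Gamma (a%:Z - b%:Z)%:~R = 0.
  apply: delta_hat_diff_eq0 => // g h gG hG gh.
  apply: (sum_cexpi_eq0_of_spectral_pair hspec); [exact: sub_plus_Z|exact: sub_plus_Z|].
  move: gG hG gh; rewrite hGamma => /imfsetP[i _ ->] /imfsetP[j _ ->] gij.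
  by apply: hgamma; apply: contraNneq gij => ->.
split=> [rat|noF].
- have -> : exceptional_zeros Gamma = set0; last by rewrite setI0.
  rewrite /exceptional_zeros -subset0 => k [Gk]; apply.
  move=> C /imfsetP[g gG ->]; rewrite (_ : [fset _ in _ | _]%fset = Gamma)//.
  apply/fsetP => h; rewrite !inE/=; apply: andb_idr => hG; apply/asboolP.
  have [p _ <-] := rat _ (sub_plus_Z _ gG); have [q _ <-] := rat _ (sub_plus_Z _ hG).
  by exists (p - q) => //; rewrite rmorphB.
- pose C := [fset h in Gamma | rat_equiv 0 h]%fset.
  have C0 : 0 \in C.
    by rewrite !inE Gamma0/=; apply/asboolP; exists 0 => //; rewrite subrr rmorph0.
  have CGamma : C = Gamma.
    apply/eqP; rewrite eqEfcard; apply/andP; split; first exact: fset_sub.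
    rewrite GammaA; apply: card_le_of_delta_hat_diff.
      by rewrite cardfs_gt0; apply/fset0Pn; exists 0.
    move=> a b aA bA ab; apply: contrapT => Cab.
    have : (diff_set A `&` exceptional_zeros Gamma) (a%:Z - b%:Z).
      split; first by exists a => //; exists b.
      split; first exact: zeros.
      by move=> /(_ C) X; apply/Cab/X; apply/imfsetP; exists 0.
    by rewrite noF.
  apply: plus_Z_sub_rational => g; rewrite -CGamma !inE => /andP[_ /asboolP[q _]].
  by rewrite sub0r => qg; exists (- q) => //; rewrite rmorphN/= qg opprK.
Qed.
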